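(* Let $n\in\mathbb{N}$, let $B\subseteq\mathbb{N}^n$ be a block, and let $X_1,\ldots,X_n,Y_1,\ldots,Y_n$ be linearly stable sequence classes such that the $2n$-tuple $(X_1,\ldots,X_n,Y_1,\ldots,Y_n)$ is $B$-compatible. Then $\mathcal{L}_{B;X_1,\ldots,X_n;Y_1,\ldots,Y_n}$, endowed with the norm $\|\cdot\|_{B;X_1,\ldots,X_n;Y_1,\ldots,Y_n}$, is a Banach multi-ideal (Banach ideal of $n$-linear operators).
   Context: All Banach spaces are over $\mathbb{K}=\mathbb{R}$ or $\mathbb{C}$; $\mathcal{L}(E_1,\ldots,E_n;F)$ is the Banach space of continuous $n$-linear operators from $E_1\times\cdots\times E_n$ to $F$ with the usual sup norm. $E\stackrel{1}{\hookrightarrow}F$ means that $E$ is a linear subspace of $F$ and $\|x\|_F\le\|x\|_E$ for every $x\in E$. $c_{00}(E)$ is the space of eventually null $E$-valued sequences, $\ell_\infty(E)$ the space of bounded $E$-valued sequences with the sup norm; $(e_j)_{j=1}^\infty$ are the canonical unit vectors of scalar sequence spaces. Sequence spaces carry the coordinatewise operations. A sequence class is a rule $X$ assigning to each Banach space $E$ a Banach space $X(E)$ of $E$-valued sequences such that $c_{00}(E)\subset X(E)\stackrel{1}{\hookrightarrow}\ell_\infty(E)$ and $\|e_j\|_{X(\mathbb{K})}=1$ for every $j$. $X$ is linearly stable if for all Banach spaces $E,F$, every $u\in\mathcal{L}(E;F)$ and every $(x_j)_{j=1}^\infty\in X(E)$, one has $(u(x_j))_{j=1}^\infty\in X(F)$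 and $\|(u(x_j))_{j=1}^\infty\|_{X(F)}\le\|u\|\cdot\|(x_j)_{j=1}^\infty\|_{X(E)}$. For sequence classes $Y_1,\ldots,Y_n$ put $\mathbf{Y}_n(F)=Y_1(Y_2(\cdots(Y_n(F))\cdots))$. For $N\subseteq\mathbb{N}$, $(x_j)_{j\in N}$ denotes the sequence whose $j$-th coordinate is $x_j$ if $j\in N$ and $0$ if $j\notin N$. A block is a nonempty subset $B\subseteq\mathbb{N}^n$; for $j_1,\ldots,j_{n-1}\in\mathbb{N}$, $B^{j_1,\ldots,j_{n-1}}=\{j_n\in\mathbb{N}:(j_1,\ldots,j_n)\in B\}$ (for $n=1$ this is $B$). $T\in\mathcal{L}(E_1,\ldots,E_n;F)$ is $(B;X_1,\ldots,X_n;Y_1,\ldots,Y_n)$-summing if $\left(\cdots\left(\left(T(x^{(1)}_{j_1},\ldots,x^{(n)}_{j_n})\right)_{j_n\in B^{j_1,\ldots,j_{n-1}}}\right)_{j_{n-1}=1}^\infty\cdots\right)_{j_1=1}^\infty\in\mathbf{Y}_n(F)$ whenever $(x^{(k)}_j)_{j=1}^\infty\in X_k(E_k)$, $k=1,\ldots,n$. In this case the induced map $\widehat{T}_B\colon X_1(E_1)\times\cdots\times X_n(E_n)\to\mathbf{Y}_n(F)$, sending the $n$-tuple of sequences to the iterated sequence above, is a continuous $n$-linear operator. The set of all such $T$ is $\mathcal{L}_{B;X_1,\ldots,X_n;Y_1,\ldots,Y_n}(E_1,\ldots,E_n;F)$, and $\|T\|_{B;X_1,\ldots,X_n;Y_1,\ldots,Y_n}=\|\widehat{T}_B\|$.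 $(X_1,\ldots,X_n,Y_1,\ldots,Y_n)$ is $B$-compatible if for all $(\lambda^{(k)}_j)_{j=1}^\infty\in X_k(\mathbb{K})$, $k=1,\ldots,n$, the iterated sequence $(\cdots((\lambda^{(1)}_{j_1}\cdots\lambda^{(n)}_{j_n})_{j_n\in B^{j_1,\ldots,j_{n-1}}})_{j_{n-1}=1}^\infty\cdots)_{j_1=1}^\infty$ belongs to $\mathbf{Y}_n(\mathbb{K})$ and its norm there is at most $\prod_{k=1}^n\|(\lambda^{(k)}_j)_{j=1}^\infty\|_{X_k(\mathbb{K})}$. Banach ideal of $n$-linear operators (Banach multi-ideal): a class $\mathcal{M}$ of continuous $n$-linear operators with a function $\|\cdot\|_{\mathcal{M}}\colon\mathcal{M}\to[0,\infty)$ such that, for all Banach spaces, (i) $\mathcal{M}(E_1,\ldots,E_n;F)=\mathcal{M}\cap\mathcal{L}(E_1,\ldots,E_n;F)$ is a linear subspace of $\mathcal{L}(E_1,\ldots,E_n;F)$ containing the operators of finite type (finite linear combinations of operators $(x_1,\ldots,x_n)\mapsto\varphi_1(x_1)\cdots\varphi_n(x_n)b$ with $\varphi_k$ in the topological dual of $E_k$, $b\in F$), and $\|\cdot\|_{\mathcal{M}}$ is a complete norm on it; (ii) the operator $\mathbb{K}^n\ni(\lambda_1,\ldots,\lambda_n)\mapsto\lambda_1\cdots\lambda_n\in\mathbb{K}$ has $\|\cdot\|_{\mathcal{M}}$-norm $1$; (iii) if $T\in\mathcal{M}(E_1,\ldots,E_n;F)$, $u_k\in\mathcal{L}(G_k;E_k)$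 and $v\in\mathcal{L}(F;H)$, then $v\circ T\circ(u_1,\ldots,u_n)\in\mathcal{M}(G_1,\ldots,G_n;H)$ with $\|v\circ T\circ(u_1,\ldots,u_n)\|_{\mathcal{M}}\le\|v\|\,\|T\|_{\mathcal{M}}\,\|u_1\|\cdots\|u_n\|$. *)

(* Defs.v *)
From HB Require Import structures.
From mathcomp Require Import all_boot all_order all_algebra.
From mathcomp Require Import complex.
From mathcomp Require Import boolp classical_sets functions reals topology.
From mathcomp Require Import normedtype.

Set Implicit Arguments.
Unset Strict Implicit.
Unset Printing Implicit Defensive.

Import Order.TTheory GRing.Theory Num.Theory.
Import numFieldNormedType.Exports.

Local Open Scope classical_set_scope.
Local Open Scope ring_scope.

Variant scalar_kind := RealScalars | ComplexScalars.

Definition scalar_field (R : realType) (s : scalar_kind) : numFieldType :=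
  match s with RealScalars => R | ComplexScalars => R[i] end.

Lemma complex_complete (R : realType) (F : set_system (R[i] : numFieldType)^o) :
  ProperFilter F -> cauchy F -> cvg F.
Proof.
move=> FF /cauchyP Fc.
have normRe (z : R[i]) : (`|complex.Re z|%:C <= `|z|)%C by exact: normc_ge_Re.
have normIm (z : R[i]) : (`|complex.Im z|%:C <= `|z|)%C.
  case: z => a b; rewrite normc_def /= lecE /= eqxx /=.
  by rewrite -sqrtr_sqr ler_wsqrtr// lerDr sqr_ge0.
have normD (z : R[i]) : (`|z| <= (`|complex.Re z| + `|complex.Im z|)%:C)%C.
  case: z => a b; rewrite normc_def /= lecE /= eqxx /=.
  rewrite -[leRHS]ger0_norm ?addr_ge0// -sqrtr_sqr ler_wsqrtr// sqrrD.
  by rewrite !real_normK ?num_real// lerD2r lerDl mulrn_wge0 ?mulr_ge0.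
have cproj (f : R[i] -> R) : (forall x y, f (x - y) = f x - f y) ->
    (forall z, `|f z|%:C%C <= `|z|) -> cvg (f @ F).
  move=> fB fn; apply: (@R_complete R); apply/cauchy_exP => e e0.
  have e0C : 0 < (e%:C)%C by rewrite ltcR.
  have [z Fz] := Fc _ e0C.
  exists (f z); change (F (f @^-1` ball (f z) e)); apply: filterS Fz => y.
  rewrite -ball_normE => zy; change (`|f z - f y| < e); rewrite -fB -ltcR.
  exact: le_lt_trans (fn _) zy.
have /cvg_ex[/= a Fa] := cproj _ (raddfB (@complex.Re R)) normRe.
have /cvg_ex[/= b Fb] := cproj _ (raddfB (@complex.Im R)) normIm.
apply/cvg_ex; exists (a +i* b)%C; apply/cvgrPdist_lt => e.
case: e => e e'; rewrite ltcE /= => /andP[/eqP -> e0].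
have e20 : 0 < e / 2 by rewrite divr_gt0.
move/cvgrPdist_lt : Fa => /(_ _ e20) Fa; move/cvgrPdist_lt : Fb => /(_ _ e20) Fb.
near=> z; apply: le_lt_trans (normD _) _.
rewrite ltcE /= eqxx /= [ltRHS]splitr !raddfB /=; apply: ltrD; first by near: z.
by near: z.
Unshelve. all: by end_near. Qed.

Definition scalar_space (R : realType) (s : scalar_kind) : Type :=
  (scalar_field R s)^o.

HB.instance Definition _ (R : realType) (s : scalar_kind) :=
  NormedModule.copy (scalar_space R s) (scalar_field R s)^o.

Lemma scalar_space_complete (R : realType) (s : scalar_kind)
    (F : set_system (scalar_space R s)) :
  ProperFilter F -> cauchy F -> cvg F.
Proof.
by case: s F => F; [exact: (@R_complete R)|exact: (@complex_complete R)].
Qed.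

HB.instance Definition _ (R : realType) (s : scalar_kind) :=
  Uniform_isComplete.Build (scalar_space R s) (@scalar_space_complete R s).

Section Operators.
Variable K : numFieldType.
Implicit Types E F : completeNormedModType K.

(* Norms take values in K; over the complex numbers `supremum` is taken for
   the partial order of R[i], in which a set of nonnegative (hence real)
   elements has the usual supremum *)
Definition opnorm E F (u : E -> F) : K :=
  supremum 0 [set `|u x| | x in [set x : E | `|x| <= 1]].

Definition multi_opnorm n (E : 'I_n -> completeNormedModType K) F
    (T : (forall k, E k) -> F) : K :=
  supremum 0
    [set `|T x| | x in [set x : forall k, E k | forall k, `|x k| <= 1]].

Definition multilinear n (E : 'I_n -> completeNormedModType K) F
    (T : (forall k, E k) -> F) : Prop :=
  forall k (x : forall i, E i), linear (fun y : E k => T (dfwith x y)).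

Definition continuous_multilinear n (E : 'I_n -> completeNormedModType K) F :
    set ((forall k, E k) -> F) :=
  [set T | multilinear T /\
           continuous (T : prod_topology (fun k => E k) -> F)].

Definition ell_infty F : set (nat -> F) := [set x | bounded_fun x].

Definition ell_infty_norm F (x : nat -> F) : K :=
  supremum 0 (range (fun j => `|x j|)).

Definition c00 F : set (nat -> F) := [set x | \forall j \near \oo, x j = 0].

End Operators.

Section SequenceClasses.
Variables (R : realType) (s : scalar_kind).
Local Notation K := (scalar_field R s).
Local Notation KK := (scalar_space R s).
Local Notation banach := (completeNormedModType K).

Definition unit_vector (j : nat) : nat -> KK := fun i => (i == j)%:R : K.

(* The Banach space X(E) of E-valued sequences is given as a Banach space
   together with a linear injection sc_seq into the space of all sequences;
   a sequence belongs to X(E) when it is in the range of sc_seq. *)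
Record sequence_class := SequenceClass {
  sc_space :> banach -> banach;
  sc_seq : forall E : banach, {linear sc_space E -> (nat -> E)};
  sc_seq_inj : forall E : banach, injective (@sc_seq E);
  sc_c00 : forall E : banach, @c00 K E `<=` range (@sc_seq E);
  sc_ell_infty : forall (E : banach) (x : sc_space E),
    @ell_infty K E (sc_seq E x) /\ ell_infty_norm (sc_seq E x) <= `|x|;
  sc_unit : forall (j : nat) (x : sc_space KK),
    sc_seq KK x = unit_vector j -> `|x| = 1
}.

Definition linearly_stable (X : sequence_class) : Prop :=
  forall (E F : banach) (u : {linear E -> F}), continuous u ->
  forall x : X E, exists y : X F,
    sc_seq X F y = (fun j => u (sc_seq X E x j)) /\ `|y| <= opnorm u * `|x|.

Fixpoint iterated n : ('I_n -> sequence_class) -> banach -> banach :=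
  match n with
  | 0 => fun _ F => F
  | n'.+1 => fun Y F => Y ord0 (iterated (fun k => Y (lift ord0 k)) F)
  end.

(* iterated_coord is injective, so an iterated sequence with entries a_j lies
   in Y_1(... Y_n(F) ...) iff a is in the range of iterated_coord, and its norm
   there is that of the unique preimage. *)
Fixpoint iterated_coord n :
    forall (Y : 'I_n -> sequence_class) (F : banach),
      iterated Y F -> ('I_n -> nat) -> F :=
  match n with
  | 0 => fun _ _ z _ => z
  | n'.+1 => fun Y F z j =>
      iterated_coord (sc_seq (Y ord0) _ z (j ord0)) (fun k => j (lift ord0 k))
  end.

Section Summing.
Variables (n : nat) (B : set ('I_n -> nat)) (X Y : 'I_n -> sequence_class).

Definition summand_array (E : 'I_n -> banach) (F : banach)
    (T : (forall k, E k) -> F) (x : forall k, X k (E k)) : ('I_n -> nat) -> F :=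
  patch (fun=> 0) B (fun j => T (fun k => sc_seq (X k) (E k) (x k) (j k))).

Definition summing (E : 'I_n -> banach) (F : banach)
    (T : (forall k, E k) -> F) : Prop :=
  forall x : forall k, X k (E k),
  exists z : iterated Y F, iterated_coord z = summand_array T x.

Definition summing_operators (E : 'I_n -> banach) (F : banach) :
    set ((forall k, E k) -> F) :=
  [set T | @continuous_multilinear K n E F T /\ summing T].

Definition induced_map (E : 'I_n -> banach) (F : banach)
    (T : (forall k, E k) -> F) : (forall k, X k (E k)) -> iterated Y F :=
  fun x => xget 0 [set z | iterated_coord z = summand_array T x].

Definition summing_norm (E : 'I_n -> banach) (F : banach)
    (T : (forall k, E k) -> F) : K :=
  @multi_opnorm K n (fun k => X k (E k)) (iterated Y F) (induced_map T).

Definition compatible : Prop :=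
  forall l : forall k, X k KK,
  exists z : iterated Y KK,
    iterated_coord z =
      patch (fun=> 0) B
        (fun j => (\prod_(k < n) (sc_seq (X k) KK (l k) (j k) : K)) : KK) /\
    `|z| <= \prod_(k < n) `|l k|.

End Summing.

Section MultiIdeals.
Variable n : nat.

Definition elementary (E : 'I_n -> banach) (F : banach) :
    set ((forall k, E k) -> F) :=
  [set T | exists (phi : forall k, {linear E k -> KK}) (b : F),
    (forall k, continuous (phi k)) /\
    T = (fun x => (\prod_(k < n) (phi k (x k) : K)) *: b)].

Definition finite_type (E : 'I_n -> banach) (F : banach) :
    set ((forall k, E k) -> F) :=
  [set T | exists (m : nat) (c : 'I_m -> K) (S : 'I_m -> (forall k, E k) -> F),
    (forall i, elementary (S i)) /\ T = \sum_(i < m) c i *: S i].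

(* The norm of the ideal is the restriction of nrm to M. *)
Record banach_multi_ideal
    (M : forall (E : 'I_n -> banach) (F : banach), set ((forall k, E k) -> F))
    (nrm : forall (E : 'I_n -> banach) (F : banach),
      ((forall k, E k) -> F) -> K) : Prop := {
  bmi_sub : forall E F, M E F `<=` @continuous_multilinear K n E F;
  bmi_zero : forall E F, M E F 0;
  bmi_add : forall E F S T, M E F S -> M E F T -> M E F (S + T);
  bmi_scale : forall E F (c : K) T, M E F T -> M E F (c *: T);
  bmi_finite_type : forall E F, @finite_type E F `<=` M E F;
  bmi_ge0 : forall E F T, M E F T -> 0 <= nrm E F T;
  bmi_eq0 : forall E F T, M E F T -> nrm E F T = 0 -> T = 0;
  bmi_normD : forall E F S T, M E F S -> M E F T ->
    nrm E F (S + T) <= nrm E F S + nrm E F T;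
  bmi_normZ : forall E F (c : K) T, M E F T ->
    nrm E F (c *: T) = `|c| * nrm E F T;
  bmi_complete : forall (E : 'I_n -> banach) (F : banach)
      (T : nat -> (forall k, E k) -> F),
    (forall i, M E F (T i)) ->
    (forall e : K, 0 < e -> exists N : nat, forall i j : nat,
      (N <= i)%N -> (N <= j)%N -> nrm E F (T i - T j) < e) ->
    exists2 S, M E F S &
      forall e : K, 0 < e -> exists N : nat, forall i : nat,
        (N <= i)%N -> nrm E F (T i - S) < e;
  bmi_prod : nrm (fun=> KK) KK (fun x => \prod_(k < n) (x k : K)) = 1;
  bmi_comp : forall (E G : 'I_n -> banach) (F H : banach)
      (T : (forall k, E k) -> F) (u : forall k, {linear G k -> E k})
      (v : {linear F -> H}),
    M E F T -> (forall k, continuous (u k)) -> continuous v ->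
    M G H (fun x => v (T (fun k => u k (x k)))) /\
    nrm G H (fun x => v (T (fun k => u k (x k)))) <=
      opnorm v * nrm E F T * \prod_(k < n) opnorm (u k)
}.

End MultiIdeals.

End SequenceClasses.

(* Main.v *)
Require Import Defs.
From HB Require Import structures.
From mathcomp Require Import all_boot all_order all_algebra.
From mathcomp Require Import complex.
From mathcomp Require Import boolp classical_sets functions reals topology.
From mathcomp Require Import normedtype.

Set Implicit Arguments.
Unset Strict Implicit.
Unset Printing Implicit Defensive.

Import Order.TTheory GRing.Theory Num.Theory.
Import numFieldNormedType.Exports.

Local Open Scope classical_set_scope.
Local Open Scope ring_scope.

(** The heart of the matter is that a summing operator T has a bounded induced
map T^.  Coordinates of X_k(E_k) and of Y_1(...Y_n(F)...) depend continuously
on the sequence, because each of these spaces embeds with norm at most 1 in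
bounded sequences; and a coordinate of T^ is a value of T or 0.  Hence T^ has a
closed graph in each variable.  [uniform_closed_graph], a closed graph theorem
that is uniform over a pointwise bounded family, then gives boundedness one
variable at a time ([closed_multilinear_bounded]).  It is proved from
completeness, in a form valid over the complex numbers, where norms are elements
of the partially ordered field R[i].

Once T^ is bounded, |T^ x| <= |T|_B |x_1|...|x_n|.  Choosing a point j of the
block and applying this to the sequences with a single nonzero entry a_k at
place j_k, which have norm at most |a_k| by linear stability, gives
|T a| <= |T|_B |a_1|...|a_n| ([norm_le_summing_norm]).  So the summing norm
separates points, and a Cauchy sequence for it converges pointwise; the limits
of the induced maps are the induced map of the limit, whence completeness
([summing_complete]).

Linear stability of the X_k lifts the inner operators u_k to sequences, that of
the Y_k lifts the outer operator v to iterated sequences ([iterated_lift]); the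
induced map of v T (u_1, ..., u_n) is the composition of T^ with the lifts,
which is the ideal inequality ([summing_operators_comp]).

Compatibility says exactly that the product of scalars is summing with norm at
most 1; the norm is 1 since the product takes the value 1 at (1, ..., 1).  An
elementary operator is a scalar product composed with functionals phi_k inside
and with the map t |-> t b outside, so it is summing by the ideal property. *)

(** * Suprema and the archimedean property in the scalar field *)

Section Scalars.
Variables (R : realType) (s : scalar_kind).
Local Notation K := (scalar_field R s).
Implicit Types (x : K).

Lemma complex_archi (x : R[i]) : 0 <= x -> exists n : nat, x <= n%:R.
Proof.
move=> x0; have xE := RRe_real (ger0_real x0); exists (Num.bound (complex.Re x)).
rewrite -xE -(rmorph_nat (@real_complex R)) lecR.
by apply/ltW/archi_boundP; rewrite -lecR xE.
Qed.

Lemma scalar_archi x : 0 <= x -> exists n : nat, x <= n%:R.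
Proof.
case: s x => x x0 /=; last exact: complex_archi.
by exists (Num.bound x); apply/ltW/archi_boundP.
Qed.

(** An upper bound of a nonempty set of nonnegative complex numbers is itself
real, so the least upper bound of the real parts is the supremum for the partial
order of [R[i]]. *)
Lemma complex_supremums (A : set R[i]) (C : R[i]) : A !=set0 ->
  (forall y, A y -> 0 <= y) -> ubound A C -> supremums A !=set0.
Proof.
move=> [a Aa] A0 AC; have reE (x : R[i]) : A x -> ((complex.Re x)%:C)%C = x.
  by move=> /A0 /ger0_real /RRe_real.
have geRe (x y : R[i]) : A x -> x <= y -> complex.Re x <= complex.Re y.
  by move=> /reE <-; case: y => y1 y2; rewrite lecE => /andP[].
exists ((sup [set complex.Re x | x in A])%:C)%C; split => [y Ay|y yA].
  rewrite -(reE _ Ay) lecR; apply: ub_le_sup; last by exists y.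
  by exists (complex.Re C) => _ [x Ax <-]; apply: geRe => //; exact: AC.
have y0 : 0 <= y by exact: le_trans (A0 _ Aa) (yA _ Aa).
rewrite -(RRe_real (ger0_real y0)) lecR; apply: ge_sup.
  by exists (complex.Re a), a.
by move=> _ [x Ax <-]; apply: geRe => //; exact: yA.
Qed.

Lemma scalar_supremums (A : set K) C : A !=set0 -> (forall x, A x -> 0 <= x) ->
  ubound A C -> supremums A !=set0.
Proof.
case: s A C => A C; last exact: complex_supremums.
move=> [a Aa] A0 AC; exists (sup A); split.
  by move=> y Ay; apply: ub_le_sup => //; exists C.
by move=> y Ay; apply: ge_sup => //; exists a.
Qed.

Lemma supremum_ge0_supremums (A : set K) C : A !=set0 -> (forall x, A x -> 0 <= x) ->
  ubound A C -> supremums A (supremum 0 A).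
Proof.
move=> An A0 AC; rewrite /supremum; case: eqP => [A_0|_].
  by case: An => a; rewrite A_0.
by apply: xgetPex; exact: scalar_supremums An A0 AC.
Qed.

Lemma le_supremum (A : set K) C x : (forall y, A y -> 0 <= y) -> ubound A C ->
  A x -> x <= supremum 0 A.
Proof.
move=> A0 AC Ax.
by have [+ _] := supremum_ge0_supremums (ex_intro _ x Ax) A0 AC; apply.
Qed.

Lemma supremum_le (A : set K) C : 0 <= C -> (forall y, A y -> 0 <= y) ->
  ubound A C -> supremum 0 A <= C.
Proof.
move=> C0 A0 AC; have [->|/set0P An] := eqVneq A set0; first by rewrite supremum0.
by have [_] := supremum_ge0_supremums An A0 AC; apply.
Qed.

Lemma supremum_ge0 (A : set K) : (forall y, A y -> 0 <= y) -> 0 <= supremum 0 A.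
Proof.
move=> A0; rewrite /supremum; case: eqP => // /eqP/set0P[a Aa].
case: xgetP => [_ -> [+ _]|//]; move=> /(_ a Aa); exact/le_trans/A0.
Qed.

Lemma half_pow_small (e C : K) : 0 < e -> 0 <= C -> exists m : nat, C / 2 ^+ m < e.
Proof.
move=> e0 C0; have [m hm] := scalar_archi (divr_ge0 C0 (ltW e0)).
exists m; rewrite ltr_pdivrMr ?exprn_gt0// mulrC -ltr_pdivrMr//.
by apply: (le_lt_trans hm); rewrite -natrX ltr_nat ltn_expl.
Qed.

End Scalars.

(** * Convergence in Banach spaces *)

Section BanachSequences.
Variable K : numFieldType.
Implicit Types Z W : completeNormedModType K.

Lemma cvg_seqP (V : normedModType K) (a : nat -> V) (l : V) : a @ \oo --> l <->
  forall e : K, 0 < e -> exists N, forall i, (N <= i)%N -> `|l - a i| < e.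
Proof.
split=> [/cvgrPdist_lt al e e0|al].
  by have [N _ hN] := al e e0; exists N => i; exact: hN.
by apply/cvgrPdist_lt => e /al[N hN]; exists N.
Qed.

Lemma cvg_dist_le (V : normedModType K) (a : nat -> V) (l b : V) (C : K) N :
  a @ \oo --> l -> (forall i, (N <= i)%N -> `|a i - b| <= C) -> `|l - b| <= C.
Proof.
move=> /cvg_seqP al aC; apply/ler_addgt0Pr => e /al[M hM].
rewrite -(subrKA (a (maxn N M))) addrC (le_trans (ler_normD _ _))// lerD//.
  by apply: aC; exact: leq_maxl.
by apply/ltW/hM; exact: leq_maxr.
Qed.

Lemma nonexpansive_cvg (V W : normedModType K) (f : V -> W) (y : nat -> V) z :
  (forall x x', `|f x - f x'| <= `|x - x'|) -> y @ \oo --> z ->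
  (f \o y) @ \oo --> f z.
Proof.
move=> fle /cvg_seqP yz; apply/cvg_seqP => e /yz[N hN].
by exists N => i /hN; apply: le_lt_trans; exact: fle.
Qed.

Lemma cauchy_seq_cvg Z (a : nat -> Z) :
  (forall e : K, 0 < e ->
    exists N, forall i, (N <= i)%N -> `|a i - a N| < e) ->
  exists l : Z, a @ \oo --> l.
Proof.
move=> ac; suff /cvg_ex : cvg (a @ \oo) by [].
apply: cauchy_cvg; apply: cauchy_exP => e /ac[N hN].
exists (a N); exists N => // i Ni; rewrite -ball_normE /= distrC; exact: hN.
Qed.

(** The radii [r m] make the closed balls of centre [a m] and radius [r m]
nested: this serves both for the nested balls of the Baire argument and for the
summation of a geometrically small series. *)
Lemma shrinking_steps_cvg Z (a : nat -> Z) (r : nat -> K) :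
  (forall m, `|a m.+1 - a m| <= r m - r m.+1) -> (forall m, 0 <= r m) ->
  (forall e, 0 < e -> exists m, r m < e) ->
  exists2 l : Z, a @ \oo --> l & forall m, `|l - a m| <= r m.
Proof.
move=> ar r0 rs.
have dist m i : (m <= i)%N -> `|a i - a m| <= r m - r i.
  elim: i => [|i IH]; first by rewrite leqn0 => /eqP ->; rewrite !subrr normr0.
  rewrite leq_eqVlt => /predU1P[->|mi]; first by rewrite !subrr normr0.
  rewrite -(subrKA (a i)) (le_trans (ler_normD _ _))//.
  by rewrite -[leRHS](subrKA (r i)) [leRHS]addrC lerD ?IH.
have dist' m i : (m <= i)%N -> `|a i - a m| <= r m.
  by move=> /dist/le_trans; apply; rewrite gerBl.
have [|l al] := @cauchy_seq_cvg _ a.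
  by move=> e /rs[m hm]; exists m => i /dist'/le_lt_trans; apply.
by exists l => // m; exact: cvg_dist_le al (dist' m).
Qed.

Definition linear_pack (V W : lmodType K) (f : V -> W) (lf : linear f) :
  {linear V -> W} := HB.pack f (GRing.isLinear.Build K V W _ f lf).

End BanachSequences.

(** * A uniform closed graph theorem *)

Section UniformClosedGraph.
Variables (R : realType) (s : scalar_kind).
Local Notation K := (scalar_field R s).
Implicit Types Z W : completeNormedModType K.

Lemma real_le_min (x y : K) : 0 < x -> 0 < y ->
  exists z, [/\ 0 < z, z <= x & z <= y].
Proof.
move=> x0 y0; have [xy|yx] := real_leP (gtr0_real x0) (gtr0_real y0).
  by exists x.
by exists y; split => //; exact: ltW.
Qed.

(** Baire's argument: if no [A m] were dense in a ball, one could shrink a ball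
at step [m] so as to avoid [A m], and the common point of the nested balls would
belong to none of the sets. *)
Lemma countable_cover_dense_in_ball Z (A : nat -> set Z) :
  (forall z, exists m, A m z) ->
  exists m (a : Z) (r : K), 0 < r /\ forall b, `|b - a| < r ->
    forall e, 0 < e -> exists2 y, A m y & `|y - b| <= e.
Proof.
move=> cover; apply: contrapT => nodense.
have step (m : nat) (p : Z * K) : exists q : Z * K, 0 < p.2 ->
    [/\ 0 < q.2, q.2 <= p.2 / 2, `|q.1 - p.1| <= p.2 / 2 &
        forall y, `|y - q.1| <= q.2 -> ~ A m y].
  have [p0|/negP np] := boolP (0 < p.2); last by exists p.
  have p20 : 0 < p.2 / 2 by rewrite divr_gt0.
  apply: contrapT => nq; apply: nodense; exists m, p.1, (p.2 / 2); split => //.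
  move=> b bp e e0; apply: contrapT => ny; apply: nq.
  have [z [z0 zp ze]] := real_le_min p20 e0; exists (b, z) => _; split => //=.
    exact: ltW.
  by move=> y yz Ay; apply: ny; exists y => //; exact: le_trans yz ze.
have [f fP] := choice (fun mp => step mp.1 mp.2).
pose p := fix p m : Z * K := if m is m'.+1 then f (m', p m') else (0, 1).
have p0 m : 0 < (p m).2.
  by elim: m => [|m IH] /=; [exact: ltr01|have [] := fP (m, p m) IH].
have pS m := fP (m, p m) (p0 m).
have psmall m : (p m).2 <= 1 / 2 ^+ m.
  elim: m => [|m IH]; first by rewrite expr0 divr1.
  have [_ + _ _] := pS m; move=> /le_trans; apply.
  by rewrite exprSr invfM mulrA ler_pM2r ?invr_gt0.
have [m|m|e e0|l _ lp] := @shrinking_steps_cvg _ Z (fst \o p) (snd \o p).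
- have [_ h h' _] := pS m; rewrite /= (le_trans h')//.
  by rewrite lerBrDr -lerBrDl [X in X - _]splitr addrK.
- exact/ltW/p0.
- have [m hm] := half_pow_small e0 (@ler01 K).
  by exists m; exact: le_lt_trans (psmall m) hm.
have [m Al] := cover l; have [_ _ _ /(_ l)] := pS m.
by apply => //; exact: (lp m.+1).
Qed.

(** The sets where all [u i] are bounded by [m] cover [Z], so one of them is
dense in a ball, and by taking differences one is dense around 0.  Every [z] is
then the sum of a geometrically small series of vectors on which all [u i] are
controlled; the images form a convergent series, whose sum is [u i z] because
the graph is closed.  A single map gives the closed graph theorem, and a family
of bounded maps the uniform boundedness principle. *)
Lemma uniform_closed_graph Z W (I : Type) (u : I -> {linear Z -> W}) :
  (forall i (y : nat -> Z) z w, y @ \oo --> z -> (u i \o y) @ \oo --> w ->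
    w = u i z) ->
  (forall z, exists C : K, forall i, `|u i z| <= C) ->
  exists2 C : K, 0 <= C & forall i z, `|u i z| <= C * `|z|.
Proof.
move=> closed bounded.
pose A (m : nat) : set Z := [set z | forall i, `|u i z| <= m%:R].
have coverA z : exists m, A m z.
  have [i0|noi] := pselect (inhabited I); last first.
    by exists 0%N => i; case: noi.
  case: i0 => i0.
  have [C hC] := bounded z; have C0 := le_trans (normr_ge0 _) (hC i0).
  have [m Cm] := scalar_archi C0.
  by exists m => i; exact: le_trans (hC i) Cm.
have [m [a [r [r0 dense]]]] := countable_cover_dense_in_ball coverA.
have near0 b e : `|b| < r -> 0 < e ->
    exists2 y, (forall i, `|u i y| <= m%:R + m%:R) & `|b - y| <= e.
  move=> br e0; have e20 : 0 < e / 2 by rewrite divr_gt0.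
  have [|y1 Ay1 hy1] := dense (b + a) _ _ e20; first by rewrite addrK.
  have [|y2 Ay2 hy2] := dense a _ _ e20; first by rewrite subrr normr0.
  exists (y1 - y2) => [i|].
    by rewrite linearB (le_trans (ler_normB _ _))// lerD.
  rewrite [leRHS]splitr -normrN opprB.
  (* the centre [a] of the ball cancels out in the difference *)
  have -> : y1 - y2 - b = (y1 - (b + a)) - (y2 - a).
    by rewrite opprB opprD !addrA subrK addrAC.
  by rewrite (le_trans (ler_normB _ _))// lerD.
pose C : K := (m%:R + m%:R) / (r / 2).
have C0 : 0 <= C by rewrite divr_ge0 ?addr_ge0// ltW// divr_gt0.
(* Rescaled form of [near0]; the positivity of [p.2] and the bound on [p.1] are
   placed after the existential so that [choice] yields a total function. *)
have approx (p : Z * K) : exists y, 0 < p.2 -> `|p.1| <= p.2 ->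
    (forall i, `|u i y| <= C * p.2) /\ `|p.1 - y| <= p.2 / 2.
  case: p => b t /=; have [t0|/negP nt] := boolP (0 < t); last by exists 0.
  have tn0 := lt0r_neq0 t0; have rn0 : r / 2 != 0 by rewrite lt0r_neq0// divr_gt0.
  have [bt|/negP nb] := boolP (`|b| <= t); last by exists 0.
  pose c := r / 2 / t; have c0 : 0 < c by rewrite !divr_gt0.
  have [||y uy near_y] := near0 (c *: b) (c * (t / 2)).
  - rewrite normrZ gtr0_norm// (@le_lt_trans _ _ (c * t)) ?ler_pM2l//.
    by rewrite /c divfK// [ltRHS]splitr ltrDl divr_gt0.
  - by rewrite mulr_gt0// divr_gt0.
  exists (c^-1 *: y) => _ _; split => [i|].
    rewrite linearZ normrZ gtr0_norm ?invr_gt0// mulrC ler_pdivrMr// -mulrA.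
    by rewrite [t * _]mulrC /c divfK// /C divfK// uy.
  rewrite -[b](scalerK (lt0r_neq0 c0)) -scalerBr normrZ gtr0_norm ?invr_gt0//.
  by rewrite mulrC ler_pdivrMr// mulrC.
have [f fP] := choice approx.
exists (2 * C) => [|i z]; first by rewrite mulr_ge0.
have [->|z0] := eqVneq z 0; first by rewrite linear0 !normr0 mulr0.
(* [b k] is the remainder after [k] approximations, and [t k] bounds it. *)
pose t (k : nat) : K := `|z| / 2 ^+ k.
have t0 k : 0 < t k by rewrite divr_gt0 ?normr_gt0// exprn_gt0.
have tS k : t k.+1 = t k / 2 by rewrite /t exprSr invfM mulrA.
pose b := fix b k := if k is k'.+1 then b k' - f (b k', t k') else z.
have bt k : `|b k| <= t k.
  elim: k => [|k IH] /=; first by rewrite /t expr0 divr1.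
  by rewrite tS; have [] := fP (b k, t k) (t0 k) IH.
have fb k := fP (b k, t k) (t0 k) (bt k).
have tsmall D (e : K) : 0 <= D -> 0 < e -> exists k, D * t k < e.
  move=> D0 e0; have [k hk] := half_pow_small e0 (mulr_ge0 D0 (normr_ge0 z)).
  by exists k; rewrite /t mulrA.
have sz : (fun k => z - b k) @ \oo --> z.
  apply/cvg_seqP => e e0; have [k] := tsmall 1 e ler01 e0; rewrite mul1r => hk.
  exists k => j kj; rewrite opprB addrC subrK; apply: le_lt_trans hk.
  apply: le_trans (bt j) _; rewrite ler_pM2l ?normr_gt0//.
  rewrite lef_pV2 ?posrE ?exprn_gt0//.
  by rewrite ler_eXn2l// ltr1n.
have [k|k|e e0|w us wb] := @shrinking_steps_cvg _ W
    (fun k => u i (z - b k)) (fun k => 2 * C * t k).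
- rewrite -linearB /= !opprB !addrA subrK addrC addKr.
  have [/(_ i) uf _] := fb k; apply: le_trans uf _.
  rewrite -mulrBr tS {2}[t k]splitr addrK [2 * C]mulrC.
  by rewrite -[C * 2 * _]mulrA [2 * _]mulrC divfK ?pnatr_eq0.
- by apply: mulr_ge0; [rewrite mulr_ge0|exact: ltW].
- by apply: (tsmall (2 * C)); [rewrite mulr_ge0|].
rewrite -(closed _ _ _ _ sz us).
by have := wb 0%N; rewrite /= subrr linear0 subr0 /t expr0 divr1.
Qed.

End UniformClosedGraph.

(** * Bounded multilinear operators *)

Section Mix.
Variables (n : nat) (E : 'I_n -> Type).
Implicit Types x a : forall k, E k.

(** Replacing the coordinates of [a] by those of [x] one at a time leads from
[a] to [x]; statements on several variables are proved along this chain. *)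
Definition mix (m : nat) x a : forall k, E k :=
  fun k => if (k < m)%N then x k else a k.

Lemma mix0 x a : mix 0 x a = a.
Proof. exact: functional_extensionality_dep. Qed.

Lemma mix_all x a : mix n x a = x.
Proof. by apply: functional_extensionality_dep => k; rewrite /mix ltn_ord. Qed.

Lemma mixS (k : 'I_n) x a : mix k.+1 x a = dfwith (mix k x a) (x k).
Proof.
apply: functional_extensionality_dep => i; case: dfwithP => [|j kj].
  by rewrite /mix ltnSn.
by rewrite /mix ltnS leq_eqVlt eq_sym (negbTE (kj : (k : nat) != j)).
Qed.

Lemma mix_dfwith (k : 'I_n) x a (y : E k) :
  mix k x (dfwith a y) = dfwith (mix k x a) y.
Proof.
apply: functional_extensionality_dep => i; rewrite /mix.
case: (dfwithP _ y) => [|j kj]; first by rewrite ltnn dfwith_in.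
by rewrite dfwith_out.
Qed.

Lemma dfwith_id (k : 'I_n) a : dfwith a (a k) = a.
Proof. by apply: functional_extensionality_dep => i; case: dfwithP. Qed.

Lemma dfwith_mix (k : 'I_n) x a : dfwith (mix k x a) (a k) = mix k x a.
Proof. by rewrite -mix_dfwith dfwith_id. Qed.

Lemma mix_ind (P : nat -> Prop) :
  P 0%N -> (forall k : 'I_n, P k -> P k.+1) -> P n.
Proof.
move=> P0 PS; suff H m : (m <= n)%N -> P m by exact: H.
by elim: m => // m IH mn; exact: (PS (Ordinal mn) (IH (ltnW mn))).
Qed.

End Mix.

Section LinearOperators.
Variables (R : realType) (s : scalar_kind).
Local Notation K := (scalar_field R s).
Implicit Types V W : completeNormedModType K.

Lemma normalize_le1 V (x : V) : `| `|x|^-1 *: x| <= 1.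
Proof.
rewrite normrZ normfV normr_id; have [->|x0] := eqVneq x 0.
  by rewrite normr0 mulr0.
by rewrite mulVf ?normr_eq0.
Qed.

Lemma normalizeK V (x : V) : `|x| *: (`|x|^-1 *: x) = x.
Proof.
have [->|x0] := eqVneq x 0; first by rewrite !scaler0.
by rewrite scalerA mulfV ?scale1r ?normr_eq0.
Qed.

Lemma opnorm_ge0 V W (u : V -> W) : 0 <= opnorm u.
Proof. by apply: supremum_ge0 => _ [x _ <-]. Qed.

Lemma opnorm_le V W (u : V -> W) (C : K) : 0 <= C ->
  (forall x, `|u x| <= C * `|x|) -> opnorm u <= C.
Proof.
move=> C0 uC; apply: supremum_le => //; first by move=> _ [x _ <-].
by move=> _ [x /= x1 <-]; apply: le_trans (uC x) _; rewrite ler_piMr.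
Qed.

(** Continuity is what makes [opnorm u] meaningful: the supremum of an unbounded
set is 0 by convention. *)
Lemma norm_le_opnorm V W (u : {linear V -> W}) (x : V) : continuous u ->
  `|u x| <= opnorm u * `|x|.
Proof.
move=> /(_ 0)/continuous_linear_bounded/linear_boundedP[M [Mr hM]].
have M0 : M < `|M| + 1 by rewrite ltr_pwDr// real_ler_norm.
have uM := hM _ M0.
rewrite -{1}[x]normalizeK linearZ normrZ normr_id mulrC ler_wpM2r//.
apply: (@le_supremum _ _ _ (`|M| + 1)) => [_ [y _ <-]//|_ [y /= y1 <-]|].
  by apply: le_trans (uM y) _; rewrite ler_piMr// addr_ge0.
by exists (`|x|^-1 *: x) => //=; exact: normalize_le1.
Qed.

Lemma linear_bound_continuous V W (u : {linear V -> W}) (C : K) :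
  0 <= C -> (forall x, `|u x| <= C * `|x|) -> continuous u.
Proof.
move=> C0 uC; apply/bounded_linear_continuous/linear_boundedP.
exists C; split; first exact: ger0_real.
by move=> M CM x; apply: le_trans (uC x) _; rewrite ler_wpM2r// ltW.
Qed.

End LinearOperators.

Section Multilinear.
Variables (R : realType) (s : scalar_kind).
Local Notation K := (scalar_field R s).
Variables (n : nat) (E : 'I_n -> completeNormedModType K).
Variable F : completeNormedModType K.
Implicit Types (T : (forall k, E k) -> F) (x a : forall k, E k).

Definition unit_ball : set (forall k, E k) := [set x | forall k, `|x k| <= 1].

Definition bounded_on_ball T := exists C : K, forall x, unit_ball x -> `|T x| <= C.

Lemma multilinear_scale T (c : 'I_n -> K) x : multilinear T ->
  T (fun k => c k *: x k) = (\prod_k c k) *: T x.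
Proof.
move=> mT; set cx := fun k => _.
have : T (mix n cx x) = (\prod_(k < n | (k < n)%N) c k) *: T x.
  apply: (mix_ind (P := fun m =>
    T (mix m cx x) = (\prod_(k < n | (k < m)%N) c k) *: T x)) => [|k IH].
    by rewrite mix0 big_pred0// scale1r.
  rewrite mixS (bigD1 k)//= -[RHS]scalerA.
  rewrite (eq_bigl (fun i : 'I_n => (i < k)%N)); last first.
    by move=> i /=; rewrite ltnS ltn_neqAle andbC.
  rewrite -IH -{2}(dfwith_mix k cx x).
  exact: (linearZ_LR (linear_pack (mT k (mix k cx x)))).
by rewrite mix_all => ->; congr (_ *: _); apply: eq_bigl => k; rewrite ltn_ord.
Qed.

Lemma multi_opnorm_ge0 T : 0 <= multi_opnorm T.
Proof. by apply: supremum_ge0 => _ [x _ <-]. Qed.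

Lemma multi_opnorm_le T (C : K) : 0 <= C ->
  (forall x, unit_ball x -> `|T x| <= C) -> multi_opnorm T <= C.
Proof.
move=> C0 TC; apply: supremum_le => //; first by move=> _ [x _ <-].
by move=> _ [x /TC Tx <-].
Qed.

(** Homogeneity reduces the bound to the unit ball: [x = `|x| *: (`|x|^-1 *: x)]
holds for [x = 0] as well. *)
Lemma norm_le_multi_opnorm T x : multilinear T -> bounded_on_ball T ->
  `|T x| <= multi_opnorm T * \prod_k `|x k|.
Proof.
move=> mT [C TC].
have -> : x = (fun k => `|x k| *: (`|x k|^-1 *: x k)).
  by apply: functional_extensionality_dep => k; rewrite normalizeK.
rewrite multilinear_scale// normrZ normr_prod mulrC.
have -> : \prod_k `| `|x k| *: (`|x k|^-1 *: x k)| = \prod_k `| `|x k| |.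
  by apply: eq_bigr => k _; rewrite normalizeK normr_id.
rewrite ler_wpM2r ?prodr_ge0//.
apply: (@le_supremum _ _ _ C) => [_ [y _ <-]//|_ [y /TC ? <-]//|].
by exists (fun k => `|x k|^-1 *: x k) => // k; exact: normalize_le1.
Qed.

Lemma unit_ball_bound T (C : K) : 0 <= C ->
  (forall x, `|T x| <= C * \prod_k `|x k|) ->
  forall x, unit_ball x -> `|T x| <= C.
Proof.
move=> C0 TC x x1; apply: le_trans (TC x) _; rewrite ler_piMr//.
by apply: prodr_ile1 => k _; rewrite normr_ge0 x1.
Qed.

(** Suppose [T] is bounded in its first [k] variables for each choice of the
others.  The maps obtained from [T] by fixing the first [k] variables in the
unit ball form a pointwise bounded family of closed linear maps of the next
variable, so [uniform_closed_graph] bounds [T] in [k + 1] variables. *)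
Lemma closed_multilinear_bounded T : multilinear T ->
  (forall k x (y : nat -> E k) z w, y @ \oo --> z ->
    (fun m => T (dfwith x (y m))) @ \oo --> w -> w = T (dfwith x z)) ->
  bounded_on_ball T.
Proof.
move=> mT closed.
have [C hC] : exists C : K, forall x, unit_ball x -> `|T (mix n x (fun=> 0))| <= C.
  apply: (mix_ind (P := fun m => forall a,
    exists C : K, forall x, unit_ball x -> `|T (mix m x a)| <= C)) => [a|k IH a].
    by exists `|T a| => x _; rewrite mix0.
  pose u (x : {x | unit_ball x}) := linear_pack (mT k (mix k (sval x) a)).
  have [x y z w yz uw|y|C C0 uC] := @uniform_closed_graph R s _ _ _ u.
  - exact: (closed k (mix k (sval x) a) y z w yz uw).
  - have [C hC] := IH (dfwith a y).
    by exists C => -[x x1]; rewrite /= -mix_dfwith; exact: hC.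
  - exists C => x x1; rewrite mixS; apply: le_trans (uC (exist _ x x1) (x k)) _.
    by rewrite ler_piMr//; exact: x1.
by exists C => x /hC; rewrite mix_all.
Qed.

Lemma continuous_slice T k x : continuous (T : prod_topology E -> F) ->
  continuous (fun y : E k => T (dfwith x y)).
Proof.
move=> cT y; apply: (@continuous_comp _ (prod_topology E)); last exact: cT.
exact: dfwith_continuous.
Qed.

Lemma multilinear_mixS T (k : 'I_n) x a : multilinear T ->
  T (mix k.+1 x a) = T (dfwith (mix k x a) (x k - a k)) + T (mix k x a).
Proof.
move=> mT; rewrite mixS -{3}(dfwith_mix k x a).
have := linearD (linear_pack (mT k (mix k x a))) (x k - a k) (a k).
by rewrite subrK.
Qed.

(** Along the chain of [mix], each step changes the value of [T] by its value at
a point with coordinate [x k - a k], which tends to 0, while the other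
coordinates stay bounded. *)
Lemma bounded_multilinear_cvg T (G : set_system (forall k, E k)) a :
  Filter G -> multilinear T -> bounded_on_ball T ->
  (forall k, (fun x => x k) @ G --> a k) -> T @ G --> T a.
Proof.
move=> FG mT bT cproj; set p := multi_opnorm T.
have p0 : 0 <= p := multi_opnorm_ge0 T.
pose h m x := T (mix m x a).
have h0 : h 0%N = fun=> T a by apply: funext => x; rewrite /h mix0.
have hn : h n = T by apply: funext => x; rewrite /h mix_all.
have hS (k : 'I_n) :
    h k.+1 = (fun x => T (dfwith (mix k x a) (x k - a k))) \+ h k.
  by apply: funext => x; exact: multilinear_mixS.
suff : h n @ G --> T a by rewrite hn.
apply: (mix_ind (P := fun m => h m @ G --> T a)) => [|k IH].
  by rewrite h0; exact: cvg_cst.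
rewrite hS.
rewrite -[X in _ --> X]add0r; apply: cvgD => //.
pose D := p * \prod_(i < n | i != k) (`|a i| + 1).
have D0 : 0 <= D by rewrite mulr_ge0// prodr_ge0// => i _; rewrite addr_ge0.
apply/cvgr0Pnorm_lt => e e0.
have near_bound : \forall x \near G,
    forall i, `|a i - x i| < 1.
  apply: filter_forall => i.
  by move: (cproj i) => /cvgrPdist_lt; apply.
have e'0 : 0 < e / (D + 1) by rewrite divr_gt0// ltr_pwDr.
have near_k : \forall x \near G, `|a k - x k| < e / (D + 1).
  by move: (cproj k) => /cvgrPdist_lt; apply.
near=> x.
have xa : forall i, `|a i - x i| < 1 by near: x.
apply: le_lt_trans (norm_le_multi_opnorm _ mT bT) _; rewrite (bigD1 k)//= dfwith_in.
apply: (@le_lt_trans _ _ (D * `|x k - a k|)).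
  rewrite mulrC -mulrA mulrC ler_wpM2r// -/p mulrC /D ler_wpM2l//.
  apply: ler_prod => i ik; rewrite normr_ge0 dfwith_out 1?eq_sym//=.
  rewrite /mix; case: ifP => _; last by rewrite lerDl.
  rewrite -[x i](subrK (a i)) (le_trans (ler_normD _ _))// addrC lerD2l.
  by rewrite distrC ltW.
have : `|a k - x k| < e / (D + 1) by near: x.
rewrite distrC ltr_pdivlMr ?ltr_pwDr//; apply: le_lt_trans.
by rewrite mulrC ler_wpM2l// lerDl.
Unshelve. all: by end_near. Qed.

Lemma bounded_continuous T : multilinear T -> bounded_on_ball T ->
  continuous (T : prod_topology E -> F).
Proof.
move=> mT bT a.
have FG : Filter (nbhs (a : prod_topology E)) by exact: nbhs_filter.
apply: (@bounded_multilinear_cvg T _ a FG mT bT) => k.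
exact: (@proj_continuous 'I_n E k a).
Qed.

End Multilinear.

(** * Sequence classes and iterated sequence spaces *)

Section SequenceClassFacts.
Variables (R : realType) (s : scalar_kind).
Local Notation K := (scalar_field R s).
Local Notation KK := (scalar_space R s).
Implicit Types (E F : completeNormedModType K) (X : sequence_class R s).

Lemma sc_seq_le_norm X E (x : X E) j : `|sc_seq X E x j| <= `|x|.
Proof.
have [[M [Mr hM]] xn] := sc_ell_infty x; apply: le_trans xn.
have M1 : M < `|M| + 1 by rewrite ltr_pwDr// real_ler_norm.
apply: (@le_supremum _ _ _ (`|M| + 1)); last by exists j.
  by move=> _ [i _ <-].
by move=> _ [i _ <-]; exact: hM.
Qed.

(** The lifted map is linear because a sequence determines the element of the
class that represents it. *)
Lemma stable_lift X E F (u : {linear E -> F}) : linearly_stable X ->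
  continuous u ->
  exists v : {linear X E -> X F},
    (forall x, sc_seq X F (v x) = u \o sc_seq X E x) /\
    forall x, `|v x| <= opnorm u * `|x|.
Proof.
move=> Xs cu; have [v vP] := choice (Xs E F u cu).
have lv : linear v.
  move=> a x y; apply: (@sc_seq_inj _ _ X).
  rewrite linearP; have [-> _] := vP (a *: x + y).
  have [-> _] := vP x; have [-> _] := vP y.
  by apply: funext => j; rewrite linearP /= linearP.
by exists (linear_pack lv); split => x; have [] := vP x.
Qed.

Lemma scale_linear E (b : E) : linear (fun l : KK => (l : K) *: b).
Proof. by move=> a l l'; rewrite scalerA -scalerDl. Qed.

Definition scalar_line E (b : E) : {linear KK -> E} :=
  linear_pack (scale_linear b).

Lemma scalar_line_bound E (b : E) (l : KK) : `|scalar_line b l| <= `|b| * `|l|.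
Proof. by rewrite /= normrZ mulrC. Qed.

Lemma scalar_line_continuous E (b : E) : continuous (scalar_line b).
Proof. exact: linear_bound_continuous (normr_ge0 b) (scalar_line_bound b). Qed.

(** The sequence is the image of the scalar unit vector, of norm 1, under the map
[l |-> l x], whose norm is at most [`|x|]. *)
Lemma sc_single X E (x : E) j : linearly_stable X ->
  exists2 w : X E, sc_seq X E w j = x & `|w| <= `|x|.
Proof.
move=> Xs.
have [|e _ ej] := @sc_c00 _ _ X KK (unit_vector _ s j).
  by exists j.+1 => // i /= ji; rewrite /unit_vector gtn_eqF.
have [v [vc vn]] := stable_lift Xs (@scalar_line_continuous _ x).
exists (v e).
  by rewrite vc /= ej /unit_vector eqxx scale1r.
apply: le_trans (vn e) _; rewrite (sc_unit ej) mulr1.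
exact: opnorm_le (normr_ge0 x) (scalar_line_bound x).
Qed.

Lemma iterated_coord_linear n (Y : 'I_n -> sequence_class R s) F
    (a : K) (z w : iterated Y F) j :
  iterated_coord (a *: z + w) j = a *: iterated_coord z j + iterated_coord w j.
Proof.
elim: n Y z w j => [//|n IH] Y z w j /=.
by rewrite linearP; exact: IH.
Qed.

Lemma iterated_coord_inj n (Y : 'I_n -> sequence_class R s) F
    (z w : iterated Y F) : iterated_coord z = iterated_coord w -> z = w.
Proof.
elim: n Y z w => [|n IH] Y z w /= zw; first exact: (congr1 (@^~ (fun=> 0%N)) zw).
apply: (@sc_seq_inj _ _ (Y ord0)); apply: funext => i; apply: IH.
apply: funext => j.
pose ij (k : 'I_n.+1) := if unlift ord0 k is Some k' then j k' else i.
have := congr1 (@^~ ij) zw; rewrite /= {1 3}/ij unlift_none.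
by have -> : (fun k => ij (lift ord0 k)) = j
  by apply: funext => k; rewrite /ij liftK.
Qed.

Lemma iterated_coord_le_norm n (Y : 'I_n -> sequence_class R s) F
    (z : iterated Y F) j : `|iterated_coord z j| <= `|z|.
Proof.
elim: n Y z j => [//|n IH] Y z j /=.
exact: le_trans (IH _ _ _) (sc_seq_le_norm _ _).
Qed.

Lemma iterated_coord0 n (Y : 'I_n -> sequence_class R s) F j :
  iterated_coord (0 : iterated Y F) j = 0.
Proof.
have := iterated_coord_linear (-1) (0 : iterated Y F) 0 j.
by rewrite scaler0 addr0 scaleN1r addNr.
Qed.

Lemma iterated_coord_dist n (Y : 'I_n -> sequence_class R s) F
    (z w : iterated Y F) j :
  `|iterated_coord z j - iterated_coord w j| <= `|z - w|.
Proof.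
have -> : iterated_coord z j - iterated_coord w j = iterated_coord (z - w) j.
  by rewrite -scaleN1r addrC -iterated_coord_linear scaleN1r addrC.
exact: iterated_coord_le_norm.
Qed.

(** The lift to the inner iterated space is a bounded operator of norm at most
[opnorm u], so the outermost class can lift it again. *)
Lemma iterated_lift n (Y : 'I_n -> sequence_class R s) E F
    (u : {linear E -> F}) : (forall k, linearly_stable (Y k)) -> continuous u ->
  exists v : {linear iterated Y E -> iterated Y F},
    (forall z, iterated_coord (v z) = u \o iterated_coord z) /\
    forall z, `|v z| <= opnorm u * `|z|.
Proof.
move=> Ys cu; elim: n Y Ys => [|n IH] Y Ys.
  by exists u; split => // z; exact: norm_le_opnorm.
have [v [vc vn]] := IH (fun k => Y (lift ord0 k)) (fun k => Ys _).
have cv : continuous v := linear_bound_continuous (opnorm_ge0 u) vn.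
have [w [wc wn]] := stable_lift (Ys ord0) cv.
exists w; split => [z|z]; last first.
  apply: le_trans (wn z) _; rewrite ler_wpM2r//.
  by apply: opnorm_le vn; exact: opnorm_ge0.
by apply: funext => j /=; rewrite wc /= vc.
Qed.

End SequenceClassFacts.

(** * The induced map and the summing norm *)

Section InducedMap.
Variables (R : realType) (s : scalar_kind) (n : nat).
Variables (B : set ('I_n -> nat)) (X Y : 'I_n -> sequence_class R s).
Local Notation K := (scalar_field R s).
Local Notation ops := (summing_operators B X Y).
Local Notation nrm := (summing_norm B X Y).
Local Notation induced := (induced_map B Y).

Variables (E : 'I_n -> completeNormedModType K) (F : completeNormedModType K).
Implicit Types (S T : (forall k, E k) -> F) (x : forall k, X k (E k)).

Lemma summand_in T x j : B j ->
  summand_array B T x j = T (fun k => sc_seq (X k) (E k) (x k) (j k)).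
Proof. by move=> Bj; rewrite /summand_array /patch mem_set. Qed.

Lemma summand_out T x j : ~ B j -> summand_array B T x j = 0.
Proof. by move=> Bj; rewrite /summand_array /patch memNset. Qed.

Lemma summand_dfwith T k x (y : X k (E k)) j : B j ->
  summand_array B T (dfwith x y) j =
  T (dfwith (fun i => sc_seq (X i) (E i) (x i) (j i)) (sc_seq (X k) (E k) y (j k))).
Proof.
move=> Bj; rewrite summand_in//; congr T; apply: functional_extensionality_dep => i.
by have [<-|ki] := eqVneq k i; [rewrite !dfwith_in|rewrite !dfwith_out].
Qed.

Lemma induced_mapK T x : summing B X Y T ->
  iterated_coord (induced T x) = summand_array B T x.
Proof. by move=> sT; exact: (xgetPex 0 (sT x)). Qed.

Lemma induced_mapE T x (z : iterated Y F) : iterated_coord z = summand_array B T x ->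
  induced T x = z.
Proof.
move=> zT; apply: iterated_coord_inj; rewrite zT.
have ex : exists z' : iterated Y F, iterated_coord z' = summand_array B T x.
  by exists z.
exact: (xgetPex 0 ex).
Qed.

Lemma summand_array_linear T k x (a : K) (y z : X k (E k)) j : multilinear T ->
  summand_array B T (dfwith x (a *: y + z)) j =
  a *: summand_array B T (dfwith x y) j + summand_array B T (dfwith x z) j.
Proof.
move=> mT; have [Bj|Bj] := pselect (B j); last first.
  by rewrite !summand_out// scaler0 addr0.
by rewrite !summand_dfwith// linearP; exact: mT.
Qed.

Lemma induced_map_multilinear T : multilinear T -> summing B X Y T ->
  @multilinear K n (fun k => X k (E k)) (iterated Y F) (induced T).
Proof.
move=> mT sT k x a y z; apply: induced_mapE; apply: funext => j.
by rewrite summand_array_linear// iterated_coord_linear !induced_mapK.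
Qed.

(** Closedness in each variable is checked on coordinates: on the block they are
values of the continuous operator [T], outside it they vanish. *)
Lemma induced_map_bounded T : ops T ->
  @bounded_on_ball R s n (fun k => X k (E k)) (iterated Y F) (induced T).
Proof.
move=> [[mT cT] sT]; apply: closed_multilinear_bounded.
  exact: induced_map_multilinear.
move=> k x y z w yz yw; apply/esym/induced_mapE; apply: funext => j.
have coord_w := nonexpansive_cvg (fun z z' => iterated_coord_dist z z' j) yw.
have yE m : iterated_coord (induced T (dfwith x (y m))) j =
    summand_array B T (dfwith x (y m)) j by rewrite induced_mapK.
rewrite (funext yE : _ \o _ = _) in coord_w.
have [Bj|Bj] := pselect (B j); last first.
  rewrite summand_out//; apply: (cvg_unique _ coord_w) => [|/=].
    exact: norm_hausdorff.
  rewrite (_ : (fun m => _) = fun=> 0); first exact: cvg_cst.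
  by apply: funext => m; rewrite summand_out.
rewrite summand_dfwith//; apply: (cvg_unique _ coord_w) => [|/=].
  exact: norm_hausdorff.
rewrite (funext (fun m => summand_dfwith T x (y m) Bj)).
pose xj i := sc_seq (X i) (E i) (x i) (j i).
have coord_y : (fun m => sc_seq (X k) (E k) (y m) (j k)) @ \oo -->
    sc_seq (X k) (E k) z (j k).
  apply: (nonexpansive_cvg (f := fun v => sc_seq (X k) (E k) v (j k)) _ yz) => v v'.
  by have := sc_seq_le_norm (v - v') (j k); rewrite linearB.
have cT_slice := @continuous_slice _ _ _ _ _ _ k xj cT.
exact: (continuous_cvg _ (cT_slice (sc_seq (X k) (E k) z (j k))) coord_y).
Qed.

Lemma induced_le_summing_norm T x : ops T -> `|induced T x| <= nrm T * \prod_k `|x k|.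
Proof.
move=> oT; have bT := induced_map_bounded oT; have [[mT _] sT] := oT.
exact: (norm_le_multi_opnorm x (induced_map_multilinear mT sT) bT).
Qed.

Lemma summing_norm_ge0 T : 0 <= nrm T.
Proof. exact: multi_opnorm_ge0. Qed.

(** [T a] is a coordinate of the induced map at the sequences that carry [a k]
at one place [j k], for any [j] in the block. *)
Lemma norm_le_summing_norm T : B !=set0 -> (forall k, linearly_stable (X k)) ->
  ops T -> forall a, `|T a| <= nrm T * \prod_k `|a k|.
Proof.
move=> [j Bj] Xs oT a; have [_ sT] := oT.
have [x xP] : exists x : forall k, X k (E k), forall k,
    sc_seq (X k) (E k) (x k) (j k) = a k /\ `|x k| <= `|a k|.
  have h k : exists w : X k (E k),
      sc_seq (X k) (E k) w (j k) = a k /\ `|w| <= `|a k|.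
    by have [w] := sc_single (a k) (j k) (Xs k); exists w.
  by exists (fun k => sval (cid (h k))) => k; exact: svalP (cid (h k)).
have -> : T a = iterated_coord (induced T x) j.
  rewrite induced_mapK// summand_in//; congr T.
  by apply: functional_extensionality_dep => k; have [-> _] := xP k.
apply: le_trans (iterated_coord_le_norm _ _) _.
apply: le_trans (induced_le_summing_norm x oT) _; rewrite ler_wpM2l ?summing_norm_ge0//.
by apply: ler_prod => k _; rewrite normr_ge0; have [_ ->] := xP k.
Qed.

Lemma summing_operatorsI T (C : K) : multilinear T -> summing B X Y T ->
  (forall a, unit_ball a -> `|T a| <= C) -> ops T.
Proof.
move=> mT sT TC; do 2?split => //.
by apply: bounded_continuous => //; exists C.
Qed.

Lemma induced_map_linear (c : K) S T x : summing B X Y S -> summing B X Y T ->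
  iterated_coord (c *: induced S x + induced T x) = summand_array B (c *: S + T) x.
Proof.
move=> sS sT; apply: funext => j; rewrite iterated_coord_linear !induced_mapK//.
have [Bj|Bj] := pselect (B j); last by rewrite !summand_out// scaler0 addr0.
by rewrite !summand_in.
Qed.

End InducedMap.

(** * The normed space of summing operators *)

Section NormedSpace.
Variables (R : realType) (s : scalar_kind) (n : nat).
Variables (B : set ('I_n -> nat)) (X Y : 'I_n -> sequence_class R s).
Local Notation K := (scalar_field R s).
Local Notation banach := (completeNormedModType K).
Local Notation ops := (summing_operators B X Y).
Local Notation nrm := (summing_norm B X Y).
Local Notation induced := (induced_map B Y).
Hypothesis B_neq0 : B !=set0.
Hypothesis X_stable : forall k, linearly_stable (X k).
Variables (E : 'I_n -> banach) (F : banach).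
Implicit Types (S T : (forall k, E k) -> F) (c : K).

Lemma summing_on_ball T : ops T -> forall a, unit_ball a -> `|T a| <= nrm T.
Proof.
move=> oT; apply: unit_ball_bound; first exact: summing_norm_ge0.
exact: norm_le_summing_norm.
Qed.

Lemma induced_on_ball T : ops T ->
  forall x : forall k, X k (E k), (forall k, `|x k| <= 1) -> `|induced T x| <= nrm T.
Proof.
move=> oT; apply: unit_ball_bound; first exact: summing_norm_ge0.
by move=> x; exact: induced_le_summing_norm.
Qed.

Lemma iterated_coord_array0 (x : forall k, X k (E k)) :
  iterated_coord (0 : iterated Y F) = summand_array B (0 : (forall k, E k) -> F) x.
Proof.
apply: funext => j; rewrite iterated_coord0.
by rewrite /summand_array /patch; case: ifP.
Qed.

Lemma summing_operators0 : ops (0 : (forall k, E k) -> F).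
Proof.
apply: (summing_operatorsI (C := 0)) => [k x a y z|x|a _].
- by rewrite scaler0 addr0.
- by exists 0; exact: iterated_coord_array0.
- by rewrite normr0.
Qed.

Lemma summing_operators_linear c S T : ops S -> ops T -> ops (c *: S + T).
Proof.
move=> oS oT; have [[mS _] sS] := oS; have [[mT _] sT] := oT.
apply: (summing_operatorsI (C := `|c| * nrm S + nrm T)) => [k x a y z|x|a a1].
- change (c *: S (dfwith x (a *: y + z)) + T (dfwith x (a *: y + z)) =
    a *: (c *: S (dfwith x y) + T (dfwith x y)) +
    (c *: S (dfwith x z) + T (dfwith x z))).
  rewrite (mS k x a y z : S _ = _) (mT k x a y z : T _ = _).
  by rewrite !scalerDr !scalerA [c * a]mulrC addrACA.
- by exists (c *: induced S x + induced T x); exact: induced_map_linear.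
- apply: le_trans (ler_normD _ _) _; rewrite normrZ lerD ?ler_wpM2l//.
    exact: summing_on_ball.
  exact: summing_on_ball.
Qed.

Lemma summing_norm_linear c S T : ops S -> ops T ->
  nrm (c *: S + T) <= `|c| * nrm S + nrm T.
Proof.
move=> oS oT; have [_ sS] := oS; have [_ sT] := oT.
apply: multi_opnorm_le => [|x x1].
  by rewrite addr_ge0 ?mulr_ge0 ?summing_norm_ge0.
rewrite (induced_mapE (induced_map_linear c x sS sT)).
apply: le_trans (ler_normD _ _) _; rewrite normrZ lerD ?ler_wpM2l//.
  exact: induced_on_ball.
exact: induced_on_ball.
Qed.

Lemma summing_operatorsD S T : ops S -> ops T -> ops (S + T).
Proof. by move=> oS oT; rewrite -[S]scale1r; exact: summing_operators_linear. Qed.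

Lemma summing_operatorsZ c T : ops T -> ops (c *: T).
Proof.
move=> oT; rewrite -[_ *: _]addr0.
exact: summing_operators_linear summing_operators0.
Qed.

Lemma summing_operatorsB S T : ops S -> ops T -> ops (S - T).
Proof.
move=> oS oT; apply: summing_operatorsD => //; rewrite -scaleN1r.
exact: summing_operatorsZ.
Qed.

Lemma summing_norm0 : nrm (0 : (forall k, E k) -> F) = 0.
Proof.
apply/le_anti; rewrite summing_norm_ge0 andbT.
apply: multi_opnorm_le => // x _.
by rewrite (induced_mapE (iterated_coord_array0 x)) normr0.
Qed.

Lemma summing_normD S T : ops S -> ops T -> nrm (S + T) <= nrm S + nrm T.
Proof.
move=> oS oT; rewrite -[S in leLHS]scale1r.
by apply: le_trans (summing_norm_linear _ _ _) _ => //; rewrite normr1 mul1r.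
Qed.

Lemma summing_norm_scale_le c T : ops T -> nrm (c *: T) <= `|c| * nrm T.
Proof.
move=> oT; rewrite -[_ *: _]addr0 -[leRHS]addr0 -summing_norm0.
exact: summing_norm_linear summing_operators0.
Qed.

Lemma summing_normZ c T : ops T -> nrm (c *: T) = `|c| * nrm T.
Proof.
move=> oT; apply/le_anti; rewrite summing_norm_scale_le//=.
have [->|c0] := eqVneq c 0; first by rewrite normr0 mul0r summing_norm_ge0.
rewrite -{1}[T](scalerK c0) -ler_pdivlMl ?normr_gt0// -normfV.
exact/summing_norm_scale_le/summing_operatorsZ.
Qed.

End NormedSpace.

(** * The ideal property and operators of finite type *)

Section IdealProperty.
Variables (R : realType) (s : scalar_kind) (n : nat).
Variables (B : set ('I_n -> nat)) (X Y : 'I_n -> sequence_class R s).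
Local Notation K := (scalar_field R s).
Local Notation KK := (scalar_space R s).
Local Notation banach := (completeNormedModType K).
Local Notation ops := (summing_operators B X Y).
Local Notation nrm := (summing_norm B X Y).
Local Notation induced := (induced_map B Y).
Hypothesis B_neq0 : B !=set0.
Hypothesis X_stable : forall k, linearly_stable (X k).
Hypothesis Y_stable : forall k, linearly_stable (Y k).

(** With [w k] the lift of [u k] to sequences and [V] the lift of [v] to
iterated sequences, the induced map of the composition is [V] after that of [T]
after the [w k], so its norm is bounded by the product of the norms. *)
Lemma summing_operators_comp (E G : 'I_n -> banach) (F H : banach)
    (T : (forall k, E k) -> F) (u : forall k, {linear G k -> E k})
    (v : {linear F -> H}) :
  ops T -> (forall k, continuous (u k)) -> continuous v ->
  ops (fun x => v (T (fun k => u k (x k)))) /\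
  nrm (fun x => v (T (fun k => u k (x k)))) <=
    opnorm v * nrm T * \prod_(k < n) opnorm (u k).
Proof.
move=> oT cu cv; have [[mT _] sT] := oT; set vTu := fun x => _.
set C := _ * _ * _.
have C0 : 0 <= C.
  by rewrite !mulr_ge0 ?opnorm_ge0 ?summing_norm_ge0 ?prodr_ge0// => k _;
    exact: opnorm_ge0.
have [w wP] : exists w : forall k, {linear X k (G k) -> X k (E k)}, forall k,
    (forall x, sc_seq (X k) (E k) (w k x) = u k \o sc_seq (X k) (G k) x) /\
    forall x, `|w k x| <= opnorm (u k) * `|x|.
  have h (k : 'I_n) := stable_lift (@X_stable k) (cu k).
  by exists (fun k => sval (cid (h k))) => k; exact: svalP (cid (h k)).
have [V [Vc Vn]] := iterated_lift Y_stable cv.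
pose wx (x : forall k, X k (G k)) k := w k (x k).
have VP x : iterated_coord (V (induced T (wx x))) = summand_array B vTu x.
  rewrite Vc; apply: funext => j; rewrite /= induced_mapK//.
  have [Bj|Bj] := pselect (B j); last by rewrite !summand_out// linear0.
  rewrite !summand_in// /vTu; congr (v (T _)).
  by apply: functional_extensionality_dep => k; have [-> _] := wP k.
split.
  apply: (summing_operatorsI (C := C)) => [k x a y z|x|a a1].
  - have slice (b : G k) : (fun i => u i (dfwith x b i)) =
        dfwith (fun i => u i (x i)) (u k b).
      apply: functional_extensionality_dep => i.
      by have [<-|ki] := eqVneq k i; [rewrite !dfwith_in|rewrite !dfwith_out].
    rewrite /vTu !slice linearP.
    by rewrite (mT k _ a (u k y) (u k z) : T _ = _) linearP.
  - by exists (V (induced T (wx x))); exact: VP.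
  - rewrite /vTu; apply: le_trans (norm_le_opnorm _ cv) _.
    rewrite /C -mulrA ler_wpM2l ?opnorm_ge0//.
    apply: le_trans (norm_le_summing_norm B_neq0 X_stable oT _) _.
    rewrite ler_wpM2l ?summing_norm_ge0//; apply: ler_prod => k _.
    rewrite normr_ge0; apply: le_trans (norm_le_opnorm _ (cu k)) _.
    by rewrite ler_piMr ?opnorm_ge0//; exact: a1.
apply: multi_opnorm_le => // x x1; rewrite (induced_mapE (VP x)).
apply: le_trans (Vn _) _.
rewrite /C -mulrA ler_wpM2l ?opnorm_ge0//.
apply: le_trans (induced_le_summing_norm (wx x) oT) _.
rewrite ler_wpM2l ?summing_norm_ge0//; apply: ler_prod => k _.
rewrite normr_ge0; have [_ wn] := wP k; apply: le_trans (wn _) _.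
by rewrite ler_piMr ?opnorm_ge0//; exact: x1.
Qed.

Section FiniteType.
Hypothesis XY_compatible : compatible B X Y.

Definition scalar_product (x : forall k : 'I_n, (fun=> KK) k) : KK :=
  \prod_(k < n) (x k : K).

Lemma scalar_product_multilinear :
  @multilinear K n (fun=> KK) KK scalar_product.
Proof.
move=> k x a y z; rewrite /scalar_product.
have split_k (b : KK) : \prod_(i < n) (@dfwith _ _ x k b i : K) =
    (b : K) * \prod_(i < n | i != k) (x i : K).
  rewrite (bigD1 k)//= dfwith_in; congr (_ * _).
  by apply: eq_bigr => i ik; rewrite dfwith_out// eq_sym.
by rewrite !split_k mulrDl -mulrA.
Qed.

Lemma summing_operators_prod :
  @summing_operators R s n B X Y (fun=> KK) KK scalar_product.
Proof.
apply: (summing_operatorsI (C := 1)) => [|x|a a1].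
- exact: scalar_product_multilinear.
- by have [z [zP _]] := XY_compatible x; exists z.
- rewrite /scalar_product normr_prod; apply: prodr_ile1 => k _.
  by rewrite normr_ge0 a1.
Qed.

Lemma summing_norm_prod :
  @summing_norm R s n B X Y (fun=> KK) KK scalar_product = 1.
Proof.
apply/le_anti/andP; split.
  apply: multi_opnorm_le => // x x1; have [z [zP zn]] := XY_compatible x.
  rewrite (induced_mapE zP); apply: le_trans zn _.
  by apply: prodr_ile1 => k _; rewrite normr_ge0 x1.
have := norm_le_summing_norm B_neq0 X_stable summing_operators_prod (fun=> 1).
by rewrite /scalar_product !big1 ?normr1 ?mulr1// => k _; rewrite normr1.
Qed.

Lemma elementary_summing (E : 'I_n -> banach) (F : banach) :
  @elementary R s n E F `<=` @summing_operators R s n B X Y E F.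
Proof.
move=> _ [phi [b [cphi ->]]].
have [oT _] := summing_operators_comp summing_operators_prod cphi
  (@scalar_line_continuous _ _ _ b).
exact: oT.
Qed.

Lemma finite_type_summing (E : 'I_n -> banach) (F : banach) :
  @finite_type R s n E F `<=` @summing_operators R s n B X Y E F.
Proof.
move=> _ [m [c [S [eS ->]]]]; elim/big_ind : _ => [|S1 S2|i _].
- exact: summing_operators0.
- exact: summing_operatorsD.
- by apply: summing_operatorsZ => //; exact: elementary_summing.
Qed.

End FiniteType.
End IdealProperty.

(** * Completeness *)

Section Completeness.
Variables (R : realType) (s : scalar_kind) (n : nat).
Variables (B : set ('I_n -> nat)) (X Y : 'I_n -> sequence_class R s).
Local Notation K := (scalar_field R s).
Local Notation banach := (completeNormedModType K).
Local Notation ops := (summing_operators B X Y).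
Local Notation nrm := (summing_norm B X Y).
Local Notation induced := (induced_map B Y).
Hypothesis B_neq0 : B !=set0.
Hypothesis X_stable : forall k, linearly_stable (X k).
Variables (E : 'I_n -> banach) (F : banach).
Implicit Types (S : (forall k, E k) -> F).

Lemma induced_mapB S S' (x : forall k, X k (E k)) :
  summing B X Y S -> summing B X Y S' ->
  induced (S - S') x = induced S x - induced S' x.
Proof.
move=> sS sS'; rewrite -[S - S']addrC -[- S']scaleN1r.
by rewrite (induced_mapE (induced_map_linear (-1) x sS' sS)) scaleN1r addrC.
Qed.

(** Both the operators [T i] and their induced maps are Cauchy at each point, by
[norm_le_summing_norm] and by definition of the norm.  The limit [W] of the
induced maps has the right coordinates to be the induced map of the limit [S],
and the Cauchy estimate for induced maps passes to the limit. *)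
Lemma summing_complete (T : nat -> (forall k, E k) -> F) :
  (forall i, ops (T i)) ->
  (forall e : K, 0 < e -> exists N : nat, forall i j : nat,
    (N <= i)%N -> (N <= j)%N -> nrm (T i - T j) < e) ->
  exists2 S, ops S & forall e : K, 0 < e -> exists N : nat, forall i : nat,
    (N <= i)%N -> nrm (T i - S) < e.
Proof.
move=> oT Tcauchy.
have oB i j : ops (T i - T j) by exact: summing_operatorsB.
have seq_cvg (V : banach) (f : nat -> V) (P : K) : 0 <= P ->
    (forall i j, `|f i - f j| <= nrm (T i - T j) * P) ->
    exists l : V, f @ \oo --> l.
  move=> P0 fT; apply: cauchy_seq_cvg => e e0.
  have P1 : 0 < P + 1 by rewrite ltr_pwDr.
  have [N hN] := Tcauchy _ (divr_gt0 e0 P1); exists N => i Ni.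
  apply: le_lt_trans (fT i N) _.
  apply: (@le_lt_trans _ _ (nrm (T i - T N) * (P + 1))).
    by rewrite ler_wpM2l ?summing_norm_ge0// lerDl.
  by rewrite -ltr_pdivlMr// hN.
have distT i j a : `|T i a - T j a| <= nrm (T i - T j) * \prod_k `|a k|.
  exact: norm_le_summing_norm (oB i j) a.
have dist_induced i j (x : forall k, X k (E k)) :
    `|induced (T i) x - induced (T j) x| <= nrm (T i - T j) * \prod_k `|x k|.
  rewrite -induced_mapB; [|by have [] := oT i|by have [] := oT j].
  exact: induced_le_summing_norm.
have limT a : exists l : F, (fun i => T i a) @ \oo --> l.
  by apply: (seq_cvg _ _ (\prod_k `|a k|)) => //; exact: prodr_ge0.
have lim_induced (x : forall k, X k (E k)) :
    exists l : iterated Y F, (fun i => induced (T i) x) @ \oo --> l.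
  by apply: (seq_cvg _ _ (\prod_k `|x k|)) => //; exact: prodr_ge0.
have [S TS] := choice limT; have [W TW] := choice lim_induced.
have WS x : iterated_coord (W x) = summand_array B S x.
  apply: funext => j.
  have coord_W := nonexpansive_cvg (fun z z' => iterated_coord_dist z z' j) (TW x).
  have TE i : iterated_coord (induced (T i) x) j = summand_array B (T i) x j.
    by rewrite induced_mapK//; have [] := oT i.
  rewrite (funext TE : _ \o _ = _) in coord_W.
  apply: (cvg_unique _ coord_W) => [|/=]; first exact: norm_hausdorff.
  have [Bj|Bj] := pselect (B j).
    rewrite summand_in// (funext (fun i => summand_in (T i) x Bj)).
    exact: TS.
  rewrite summand_out// (funext (fun i => summand_out (T i) x Bj)).
  exact: cvg_cst.
have sS : summing B X Y S by move=> x; exists (W x).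
have mS : multilinear S.
  move=> k x a y z.
  apply: (cvg_unique _ (TS (dfwith x (a *: y + z)))); first exact: norm_hausdorff.
  have TE i : T i (dfwith x (a *: y + z)) = a *: T i (dfwith x y) + T i (dfwith x z).
    by have [[mT _] _] := oT i; exact: mT.
  by rewrite (funext TE); apply: cvgD; [apply: cvgZr|]; exact: TS.
have oS : ops S.
  have [N hN] := Tcauchy 1 ltr01.
  apply: (summing_operatorsI (C := 1 + nrm (T N))) => // a a1.
  rewrite -[S a](subrK (T N a)) (le_trans (ler_normD _ _))// lerD//.
    apply: (cvg_dist_le (TS a) (N := N)) => i Ni.
    apply: le_trans (ltW (hN i N Ni (leqnn N))).
    exact: (unit_ball_bound (summing_norm_ge0 _ _ _ _) (distT i N)).
  exact: summing_on_ball.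
exists S => // e e0; have e20 : 0 < e / 2 by rewrite divr_gt0.
have [N hN] := Tcauchy _ e20; exists N => i Ni.
apply: (@le_lt_trans _ _ (e / 2)); last by rewrite [ltRHS]splitr ltrDl.
apply: multi_opnorm_le => [|x x1]; first exact: ltW.
rewrite induced_mapB//; last by have [] := oT i.
rewrite distrC (induced_mapE (WS x)); apply: (cvg_dist_le (TW x) (N := N)) => j Nj.
apply: le_trans (ltW (hN j i Nj Ni)).
apply: le_trans (dist_induced j i x) _; rewrite ler_piMr ?summing_norm_ge0//.
by apply: prodr_ile1 => k _; rewrite normr_ge0; exact: x1.
Qed.

End Completeness.

(** * The multi-ideal of summing operators *)

Theorem corollary4p7 (R : realType) (s : scalar_kind) (n : nat)
    (B : set ('I_n -> nat)) (X Y : 'I_n -> sequence_class R s) :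
  (0 < n)%N ->
  B !=set0 ->
  (forall k, linearly_stable (X k)) ->
  (forall k, linearly_stable (Y k)) ->
  compatible B X Y ->
  banach_multi_ideal (summing_operators B X Y) (summing_norm B X Y).
Proof.
move=> _ B0 Xs Ys XY; split.
- by move=> E F T [].
- by move=> E F; exact: summing_operators0.
- by move=> E F S T; exact: summing_operatorsD.
- by move=> E F c T; exact: summing_operatorsZ.
- by move=> E F; exact: finite_type_summing.
- by move=> E F T _; exact: summing_norm_ge0.
- move=> E F T oT T0; apply: funext => a; apply/eqP; rewrite -normr_le0.
  by have := norm_le_summing_norm B0 Xs oT a; rewrite T0 mul0r.
- by move=> E F S T; exact: summing_normD.
- by move=> E F c T; exact: summing_normZ.
- by move=> E F T; exact: summing_complete.
- exact: summing_norm_prod.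
- by move=> E G F H T u v; exact: summing_operators_comp.
Qed.
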